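(* Let $\epsilon>0$ be a real number. Assume there exists $\delta\in\,]0,1[$ such that, for every positive integer $n$ and every integer $a\le n$, $$\epsilon\sqrt n-1\le a\le 2\epsilon\sqrt n \ \Longrightarrow\ R(n,a)\le p(n)^\delta .$$ Then the following hold. (i) If $\epsilon<1$, then there exists $N$ such that for all integers $n\ge N$, all integers $j$ with $2\le j\le 2\lfloor \sqrt n/2\rfloor$, and all integers $a\le n$, $$\frac{j}{2}\,\epsilon\sqrt n\le a\le \frac{j+1}{2}\,\epsilon\sqrt n\ \Longrightarrow\ R(n,a)\le \bigl(2p(\epsilon\sqrt n)\bigr)^{j-2}\,p(n)^\delta .$$ (ii) For every such $\epsilon$ (without the restriction $\epsilon<1$) and every function $\tau$ with $\tau(n)=o(\sqrt n)$ as $n\to\infty$, there exists $N$ such that for all integers $n\ge N$, all integers $j$ with $2\le j\le \tau(n)$, and all integers $a\le n$, $$\frac{j}{2}\,\epsilon\sqrt n\le a\le \frac{j+1}{2}\,\epsilon\sqrt n\ \Longrightarrow\ R(n,a)\le \bigl(2p(\epsilon\sqrt n)\bigr)^{j-2}\,p(n)^\delta .$$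
   Context: For a positive integer $n$, a partition $\Pi$ of $n$ is a writing $n=n_1+n_2+\dots+n_j$ with positive integers $1\le n_1\le n_2\le\dots\le n_j$. The partition $\Pi$ is said to represent an integer $a$ if there exist $\epsilon_1,\dots,\epsilon_j\in\{0,1\}$ such that $a=\sum_{i=1}^j\epsilon_i n_i$. Notation: $p(n)$ is the number of partitions of $n$ (with $p(0)=1$), and for a real number $x\ge 0$, $p(x)$ means $p(\lfloor x\rfloor)$. For an integer $a\le n$, $R(n,a)$ is the number of partitions of $n$ that do not represent $a$. *)

(* Defs.v *)
From HB Require Import structures.
From mathcomp Require Import all_boot all_order all_algebra.
From mathcomp Require Import all_classical all_reals all_analysis.

Set Implicit Arguments.
Unset Strict Implicit.
Unset Printing Implicit Defensive.

Import Order.TTheory GRing.Theory Num.Theory.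
Import numFieldNormedType.Exports.

Local Open Scope ring_scope.

Definition is_partition (n : nat) (s : seq nat) : bool :=
  [&& sorted leq s, all (leq 1) s & sumn s == n].

(* [bool] coerces to [nat]: [e i] plays the role of epsilon_i in {0, 1}. *)
Definition represents (s : seq nat) (a : int) : bool :=
  [exists e : {ffun 'I_(size s) -> bool},
     a == (\sum_(i < size s) e i * nth 0 s i)%N%:Z].

(* A partition of n has at most n parts, each at most n, so this bounded type
   contains all of them; see [partitionsP]. *)
Definition partitions (n : nat) : {set n.-bseq 'I_n.+1} :=
  [set s : n.-bseq 'I_n.+1 | is_partition n (map val s)].

Definition npart (n : nat) : nat := #|partitions n|.

(* For x >= 0, [Num.truncn x] is the floor of x as a natural number. *)
Definition npartr (R : realType) (x : R) : nat := npart (Num.truncn x).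

Definition nonrep (n : nat) (a : int) : nat :=
  #|[set s in partitions n | ~~ represents (map val s) a]|.

Lemma partitionsP (n : nat) (s : seq nat) :
  reflect (exists2 t, t \in partitions n & map val t = s) (is_partition n s).
Proof.
apply: (iffP idP) => [ps|[t]]; last by rewrite inE => pt <-.
have /and3P[_ s_gt0 /eqP sum_s] := ps.
have size_le : (size s <= n)%N.
  rewrite -sum_s {ps sum_s}; elim: s s_gt0 => //= x s IHs /andP[x_gt0 s_gt0].
  by rewrite -add1n leq_add // IHs.
have le_sum (x : nat) (r : seq nat) : x \in r -> (x <= sumn r)%N.
  elim: r => //= y r IHr; rewrite inE => /predU1P[->|/IHr]; first exact: leq_addr.
  by move=> /leq_trans; apply; apply: leq_addl.
have sizeP : (size (map (@inord n) s) <= n)%N by rewrite size_map.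
have valE : map val (Bseq sizeP) = s.
  rewrite /= -map_comp -[RHS]map_id; apply/seq.eq_in_map => x xs /=.
  by rewrite inordK // ltnS -sum_s le_sum.
by exists (Bseq sizeP); rewrite // inE valE.
Qed.

(* Main.v *)
(** Let [b] be the integer part of [eps * sqrt n]. A partition of [n] that does
    not represent [a] either does not represent [b], or splits into a partition
    of [b] and a partition of [n - b] that does not represent [a - b], so that
    [R(n, a) <= R(n, b) + p(b) R(n - b, a - b)]. Iterating greedily, [b] being
    recomputed from the current [n], the target [a] eventually lands in the
    window of the hypothesis: while [a > 2 eps sqrt n], the new target is at
    least [eps * sqrt n], so the window is never jumped over. Since [sqrt n]
    drops by at most [eps] per step, at most [j - 2] steps occur as soon as
    [eps * (j + 1) + 2 / eps <= sqrt n], which holds for large [n] both when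
    [eps < 1] and [j <= sqrt n], and when [j = o(sqrt n)]. *)

Require Import Defs.
From HB Require Import structures.
From mathcomp Require Import all_boot all_order all_algebra.
From mathcomp Require Import all_classical all_reals all_analysis.
From mathcomp Require Import lra.

Import Order.TTheory GRing.Theory Num.Theory.
Import numFieldNormedType.Exports.

Local Open Scope classical_set_scope.
Local Open Scope ring_scope.

(** * Counting partitions as plain sequences *)

(** Dropping the bounds from the type lets partitions of different integers be compared; counts
    become sizes of duplicate-free lists. *)
Definition partition_seqs (n : nat) (P : pred (seq nat)) : seq (seq nat) :=
  [seq map val (s : n.-bseq 'I_n.+1) | s in [set s in partitions n | P (map val s)]].

Lemma size_partition_seqs (n : nat) (P : pred (seq nat)) :
  size (partition_seqs n P) = #|[set s in partitions n | P (map val s)]|.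
Proof. by rewrite size_map cardE. Qed.

Lemma mem_partition_seqs (n : nat) (P : pred (seq nat)) (s : seq nat) :
  (s \in partition_seqs n P) = is_partition n s && P s.
Proof.
apply/fintype.imageP/andP => [[t]|[/partitionsP[t tn <-] Pt]].
  by rewrite !inE => /andP[nt Pt] ->.
by exists t => //; rewrite inE tn.
Qed.

Lemma uniq_partition_seqs (n : nat) (P : pred (seq nat)) :
  uniq (partition_seqs n P).
Proof.
rewrite map_inj_uniq ?enum_uniq // => s t st.
by apply/val_inj/(inj_map val_inj).
Qed.

Lemma npart_partition_seqs (n : nat) : npart n = size (partition_seqs n predT).
Proof.
by rewrite size_partition_seqs; apply: eq_card => s; rewrite !inE andbT.
Qed.

Lemma nonrep_partition_seqs (n : nat) (a : int) :
  nonrep n a = size (partition_seqs n (fun s => ~~ represents s a)).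
Proof. by rewrite size_partition_seqs. Qed.

(** Prepending [n - m] parts equal to 1 is injective and turns a partition of [m] into one of
    [n]. *)
Lemma leq_npart (m n : nat) : (m <= n)%N -> (npart m <= npart n)%N.
Proof.
move=> mn; rewrite !npart_partition_seqs.
have injN : injective (cat (nseq (n - m) 1%N)).
  by move=> s t /eqP; rewrite eqseq_cat // eqxx => /eqP.
rewrite -(size_map (cat (nseq (n - m) 1%N))); apply: uniq_leq_size.
  by rewrite map_inj_uniq ?uniq_partition_seqs.
move=> _ /mapP[s + ->]; rewrite !mem_partition_seqs !andbT.
case/and3P=> s_le s_gt0 /eqP s_sum; apply/and3P; split.
- elim: (n - m)%N => //= k IHk.
  rewrite (path_sortedE leq_trans) IHk andbT all_cat s_gt0 andbT.
  by apply/allP => x /nseqP[->].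
- by rewrite all_cat s_gt0 andbT; apply/allP => x /nseqP[->].
- by rewrite sumn_cat sumn_nseq mul1n s_sum subnK.
Qed.

Lemma npart_gt0 (n : nat) : (0 < npart n)%N.
Proof.
apply: leq_trans (leq_npart _ _ (leq0n n)).
rewrite npart_partition_seqs; case def: partition_seqs => //.
by have := mem_partition_seqs 0 predT [::]; rewrite def.
Qed.

(** * Subsums and the splitting inequality *)

Lemma sum_nth_mask (e : bitseq) (s : seq nat) : size e = size s ->
  (\sum_(i < size s) nth false e i * nth 0 s i)%N = sumn (mask e s).
Proof.
elim: s e => [|x s IHs] [|b e] //=; first by rewrite big_ord0.
by case=> es; rewrite big_ord_recl /= IHs //; case: b; rewrite //= mul1n.
Qed.

Lemma representsP (s : seq nat) (a : int) :
  reflect (exists2 e : bitseq, size e = size s & a = (sumn (mask e s))%:Z)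
          (represents s a).
Proof.
apply: (iffP existsP) => [[e /eqP ->]|[e es ->]].
  have es : size [seq e i | i <- enum 'I_(size s)] = size s.
    by rewrite size_map size_enum_ord.
  exists [seq e i | i <- enum 'I_(size s)]; rewrite // -sum_nth_mask //.
  congr _%:Z; apply: eq_bigr => i _.
  by rewrite (nth_map i) ?size_enum_ord ?nth_ord_enum.
exists [ffun i : 'I__ => nth false e i]; rewrite -sum_nth_mask //.
by apply/eqP; congr _%:Z; apply: eq_bigr => i _; rewrite ffunE.
Qed.

(** A sub-multiset of [s] is, up to order, a subsequence, hence a mask of [s]. *)
Lemma perm_represents (s t u : seq nat) :
  perm_eq (t ++ u) s -> represents s (sumn t)%:Z.
Proof.
move=> tus.
have [x|t' /subseqP[e es ->] tt'] := (count_subseqP t s).1.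
  by rewrite -(permP tus) count_cat leq_addr.
by apply/representsP; exists e; rewrite // (perm_sumn tt').
Qed.

Lemma perm_mask_negb (T : eqType) (e : bitseq) (s : seq T) :
  size e = size s -> perm_eq (mask e s ++ mask (map negb e) s) s.
Proof.
elim: s e => [|x s IHs] [|[] e] //= [es]; first by rewrite perm_cons IHs.
rewrite -cat1s perm_catCA /= perm_cons; exact: IHs.
Qed.

(** If [s] represents [b], a mask summing to [b] and its complement cut [s] into two partitions, and
    sorting their concatenation recovers [s]. The complement cannot represent [a - b]: adding the
    parts that sum to [b] would represent [a]. *)
Lemma nonrep_split (n b : nat) (a : int) : (b <= n)%N ->
  (nonrep n a <= nonrep n b%:Z + npart b * nonrep (n - b) (a - b%:Z))%N.
Proof.
move=> bn; rewrite !nonrep_partition_seqs npart_partition_seqs.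
rewrite -(size_allpairs (fun x y => sort leq (x ++ y))) -size_cat.
apply: uniq_leq_size; first exact: uniq_partition_seqs.
move=> s; rewrite mem_cat !mem_partition_seqs => /andP[ns nsa].
rewrite ns /=; case: (boolP (represents s b)) => //= /representsP[e es].
case=> sumb; have /and3P[s_le s_gt0 /eqP s_sum] := ns.
have es' := perm_mask_negb _ _ _ es.
have part_mask f : is_partition (sumn (mask f s)) (mask f s).
  rewrite /is_partition eqxx andbT (sorted_mask leq_trans) //.
  by apply/allP => x /mem_mask; apply/allP.
apply/allpairsP; exists (mask e s, mask (map negb e) s); split => /=.
- by rewrite mem_partition_seqs andbT sumb.
- have sumC : sumn (mask (map negb e) s) = (n - b)%N.
    by rewrite -s_sum -(perm_sumn es') sumn_cat sumb addKn.
  rewrite mem_partition_seqs -sumC part_mask /=; apply: contra nsa.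
  case/representsP => f fs /(canRL (subrK _)) ->.
  rewrite sumb -PoszD addnC -sumn_cat.
  apply: (@perm_represents _ _ (mask (map negb f) (mask (map negb e) s))).
  by rewrite -catA (perm_trans _ es') // perm_cat2l perm_mask_negb.
- rewrite -[LHS](sorted_sort leq_trans) //.
  apply/esym/perm_sortP => //.
  + exact: leq_total.
  + exact: leq_trans.
  + exact: anti_leq.
Qed.

(** * Iterating the splitting *)

(** [k] bounds the number of splittings left and will be [j - 2], so [k + 3] is [j + 1]. The lower
    bound on [c] is only [eps * sqrt n], which is what survives the subtraction of [b]. *)
Lemma nonrep_le (R : realType) (eps delta : R) (k n : nat) (c : int) :
    0 < eps -> 0 <= delta ->
    (forall (n : nat) (a : int), (0 < n)%N -> a <= n%:Z ->
       eps * Num.sqrt n%:R - 1 <= a%:~R -> a%:~R <= 2 * eps * Num.sqrt n%:R ->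
       (nonrep n a)%:R <= (npart n)%:R `^ delta) ->
    c <= n%:Z -> eps * Num.sqrt n%:R <= c%:~R ->
    c%:~R <= (k%:R + 3) / 2 * eps * Num.sqrt n%:R ->
    eps * (k%:R + 3) + 2 / eps <= Num.sqrt n%:R ->
  (nonrep n c)%:R <= (2 * (npartr (eps * Num.sqrt n%:R))%:R) ^+ k
                      * (npart n)%:R `^ delta.
Proof.
move=> eps_gt0 delta_ge0 hyp.
have npartr_ge1 (x : R) : 1 <= (npartr x)%:R :> R by rewrite ler1n npart_gt0.
have npart_powR m m' : (m <= m')%N ->
    (npart m)%:R `^ delta <= (npart m')%:R `^ delta :> R.
  by move=> mm'; rewrite ge0_ler_powR ?nnegrE ?ler_nat ?leq_npart.
have ieps_gt0 : 0 < 2 / eps by rewrite divr_gt0.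
elim: k n c => [|k IHk] n c cn c_ge c_le n_ge.
  rewrite expr0 mul1r.
  have n_gt0 : 0 < Num.sqrt n%:R :> R by nra.
  apply: hyp => //; last nra; last lra.
  by rewrite lt0n; apply: contraTneq n_gt0 => ->; rewrite sqrtr0 ltxx.
rewrite -natr1 in n_ge c_le.
have k_ge0 : 0 <= k%:R :> R by [].
have [r rE] : exists r : R, Num.sqrt n%:R = r by exists (Num.sqrt n%:R).
rewrite rE in c_ge c_le n_ge *.
have r_ge0 : 0 <= r by rewrite -rE sqrtr_ge0.
have r2 : r ^+ 2 = n%:R by rewrite -rE sqr_sqrtr.
have r_gt_eps : eps < r by nra.
have n_gt0 : (0 < n)%N by rewrite -(ltr_nat R) -r2 exprn_gt0 //; lra.
have [c_le2|c_gt2] := lerP c%:~R (2 * eps * r).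
  apply: (@le_trans _ _ ((npart n)%:R `^ delta)).
    by apply: hyp => //; rewrite rE; lra.
  rewrite ler_peMl ?powR_ge0 // exprn_ege1 //.
  by have := npartr_ge1 (eps * r); lra.
set b := Num.truncn (eps * r).
have /andP[] := truncn_itv (mulr_ge0 (ltW eps_gt0) r_ge0).
rewrite -natr1 -/b => b_le b_gt.
have bn : (b <= n)%N by rewrite -(ler_nat R) -r2; nra.
have [r' r'E] : exists r' : R, Num.sqrt (n - b)%:R = r'.
  by exists (Num.sqrt (n - b)%:R).
(* As [b <= eps * r] and [eps < r], [(r - eps)^2 <= r^2 - eps * r <= n - b]. *)
have r'_ge : r - eps <= r'.
  rewrite -ler_sqr ?nnegrE -?r'E ?sqrtr_ge0 ?subr_ge0 ?(ltW r_gt_eps) //.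
  by rewrite sqr_sqrtr // natrB // -r2; nra.
have r'_le : r' <= r by rewrite -r'E -rE ler_sqrt // ler_nat leq_subr.
have IH : (nonrep (n - b) (c - b%:Z))%:R <=
    (2 * (npartr (eps * r))%:R) ^+ k * (npart n)%:R `^ delta.
  (* Rounding gives [c - b < (k + 2) / 2 * eps * r + 1]. This stays below
     [(k + 3) / 2 * eps * (r - eps)] once [eps * r] is at least [eps^2 * (k + 3) + 2]; the term
     [2 / eps] pays for the rounding. *)
  have n_ge2 : eps ^+ 2 * (k%:R + 1 + 3) + 2 <= eps * r.
    have := ler_wpM2l (ltW eps_gt0) n_ge.
    by rewrite mulrDr mulrA -expr2 mulrCA divff ?gt_eqF // mulr1.
  have kr : (k%:R + 3) / 2 * eps * (r - eps) <= (k%:R + 3) / 2 * eps * r'.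
    by rewrite ler_wpM2l // mulr_ge0 // ltW.
  apply: (le_trans (IHk _ _ _ _ _ _)).
  - by rewrite -subzn // lerD2r.
  - rewrite r'E intrB -pmulrn; nra.
  - rewrite r'E intrB -pmulrn; nra.
  - rewrite r'E; lra.
  - rewrite r'E ler_pM ?powR_ge0 ?exprn_ge0 ?npart_powR ?leq_subr //.
    rewrite lerXn2r ?nnegrE // ler_pM2l // ler_nat leq_npart // le_truncn //.
    by rewrite ler_pM2l.
(* The [- 1] in the window of [hyp] admits the rounded value [b > eps * r - 1]. *)
have hypb : (nonrep n b%:Z)%:R <= (npart n)%:R `^ delta.
  by apply: hyp => //; rewrite -?pmulrn ?rE; nra.
apply: (@le_trans _ _ (nonrep n b + npart b * nonrep (n - b) (c - b%:Z))%:R).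
  by rewrite ler_nat nonrep_split.
rewrite natrD natrM.
have P_ge1 := npartr_ge1 (eps * r).
set P : R := (npartr _)%:R in IH P_ge1 *.
have Q_ge0 : 0 <= (npart n)%:R `^ delta by exact: powR_ge0.
set Q : R := _ `^ delta in hypb IH Q_ge0 *.
have X_ge1 : 1 <= (2 * P) ^+ k by rewrite exprn_ege1 //; lra.
rewrite exprS; set X : R := (2 * P) ^+ k in IH X_ge1 *.
(* This absorbs the lone [Q]: [Q + P * X * Q <= 2 * P * X * Q], whence the factor 2. *)
have PX : 1 <= P * X by rewrite -[1 in X in X <= _]mulr1 ler_pM.
have : P * (nonrep (n - b) (c - b%:Z))%:R <= P * (X * Q) by rewrite ler_pM2l //; lra.
nra.
Qed.

(** * Thresholds for large [n] *)

Lemma sqrt_ge_near (R : realType) (M : R) :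
  exists N : nat, forall n : nat, (N <= n)%N -> M <= Num.sqrt n%:R.
Proof.
exists (Num.truncn (M ^+ 2)).+1 => n n_ge; apply: le_trans (ler_norm M) _.
rewrite -sqrtr_sqr ler_sqrt // ltW // (lt_le_trans (truncnS_gt _)) //.
by rewrite ler_nat.
Qed.

Theorem lemma1 (R : realType) (eps : R) (eps_gt0 : 0 < eps)
  (delta : R) (delta_gt0 : 0 < delta) (delta_lt1 : delta < 1)
  (hyp : forall (n : nat) (a : int), (0 < n)%N -> a <= n%:Z ->
     eps * Num.sqrt n%:R - 1 <= a%:~R -> a%:~R <= 2 * eps * Num.sqrt n%:R ->
     (nonrep n a)%:R <= (npart n)%:R `^ delta) :
  (eps < 1 ->
     exists N : nat, forall (n j : nat) (a : int),
       (N <= n)%N ->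
       (2 <= j)%N -> (j <= 2 * Num.truncn (Num.sqrt (n%:R : R) / 2))%N ->
       a <= n%:Z ->
       j%:R / 2 * eps * Num.sqrt n%:R <= a%:~R ->
       a%:~R <= (j%:R + 1) / 2 * eps * Num.sqrt n%:R ->
       (nonrep n a)%:R <=
         (2 * (npartr (eps * Num.sqrt n%:R))%:R) ^+ (j - 2)
           * (npart n)%:R `^ delta)
  /\
  (forall tau : nat -> R,
     tau =o_\oo (fun n : nat => Num.sqrt n%:R : R) ->
     exists N : nat, forall (n j : nat) (a : int),
       (N <= n)%N ->
       (2 <= j)%N -> j%:R <= tau n ->
       a <= n%:Z ->
       j%:R / 2 * eps * Num.sqrt n%:R <= a%:~R ->
       a%:~R <= (j%:R + 1) / 2 * eps * Num.sqrt n%:R ->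
       (nonrep n a)%:R <=
         (2 * (npartr (eps * Num.sqrt n%:R))%:R) ^+ (j - 2)
           * (npart n)%:R `^ delta).
Proof.
have ieps_gt0 : 0 < 2 / eps by rewrite divr_gt0.
have step (n j : nat) (a : int) : (2 <= j)%N -> a <= n%:Z ->
    j%:R / 2 * eps * Num.sqrt n%:R <= a%:~R ->
    a%:~R <= (j%:R + 1) / 2 * eps * Num.sqrt n%:R ->
    eps * (j%:R + 1) + 2 / eps <= Num.sqrt n%:R ->
    (nonrep n a)%:R <= (2 * (npartr (eps * Num.sqrt n%:R))%:R) ^+ (j - 2)
                        * (npart n)%:R `^ delta.
  move=> j_ge2 an a_ge a_le n_ge.
  have j3 : (j - 2)%:R + 3 = j%:R + 1 :> R by rewrite natrB //; lra.
  apply: nonrep_le => //; rewrite ?j3 //; first exact: ltW.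
  apply: le_trans a_ge; rewrite ler_wpM2r ?sqrtr_ge0 // ler_peMl ?(ltW eps_gt0) //.
  by move: j_ge2; rewrite -(ler_nat R); lra.
split=> [eps_lt1|tau /eqoP tau_o].
  (* With [j <= sqrt n], the premise of [step] reduces to [2 / eps + eps <= (1 - eps) * sqrt n]. *)
  have [N N_sqrt] := sqrt_ge_near _ ((2 / eps + eps) / (1 - eps)).
  exists N => n j a /N_sqrt; rewrite ler_pdivrMr ?subr_gt0 // => n_ge.
  move=> j_ge2 j_le an a_ge a_le; apply: step => //.
  have : j%:R <= Num.sqrt n%:R :> R.
    have /truncn_itv/andP[+ _] : 0 <= Num.sqrt n%:R / 2 :> R.
      by rewrite divr_ge0 ?sqrtr_ge0.
    by move: j_le; rewrite -(ler_nat R) natrM; lra.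
  by rewrite -(ler_pM2l eps_gt0); lra.
(* Half of [sqrt n] will cover [eps * j], and the other half [2 / eps + eps]. *)
have [N1 _ tau_le] : \forall n \near \oo,
    `|tau n| <= (2 * eps)^-1 * `|Num.sqrt n%:R : R|.
  by apply: tau_o; rewrite invr_gt0 mulr_gt0.
have [N2 N2_sqrt] := sqrt_ge_near _ (2 * (2 / eps + eps)).
exists (maxn N1 N2) => n j a; rewrite geq_max => /andP[/tau_le /= + /N2_sqrt n_ge].
rewrite (ger0_norm (sqrtr_ge0 _)) => {}tau_le j_ge2 j_le an a_ge a_le.
apply: step => //.
have : eps * j%:R <= Num.sqrt n%:R / 2.
  rewrite mulrC -ler_pdivlMr // (le_trans j_le) // (le_trans (ler_norm _)) //.
  by rewrite (le_trans tau_le) // invfM mulrC mulrA.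
lra.
Qed.
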